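(* Let $\mathcal{P}_A$ be an arrow space over an infinite set of points $\mathcal{P}$ satisfying Axioms 1, 2 and 4 stated in the context. Then the relation $\Re$ is an equivalence relation on $\mathcal{P}_A$.
   Context: Let $\mathcal{P}$ be an infinite set whose elements are called points. An arrow is an ordered pair of points $\overrightarrow{AB}=(A,B)$ (tail $A$, head $B$; $A=B$ is allowed). The arrow space $\mathcal{P}_A$ is the set of all arrows; two arrows are equal iff they have the same tail and the same head. Negation: $-\overrightarrow{AB}=\overrightarrow{BA}$. Arrow addition is the partial operation $\overrightarrow{AB}+_A\overrightarrow{BC}=\overrightarrow{AC}$, defined exactly when the head of the first arrow equals the tail of the second. Axiom 1: there is a given map (arrow pre-inner product) $\langle -,-\rangle_A:\mathcal{P}_A\times\mathcal{P}_A\to\mathbb{R}$ such that for all points: $\langle\overrightarrow{AB},\overrightarrow{AB}\rangle_A\ge 0$, with equality iff $A=B$; $\langle\overrightarrow{AB},\overrightarrow{CD}\rangle_A=\langle\overrightarrow{CD},\overrightarrow{AB}\rangle_A$; $\langle\overrightarrow{AB}+_A\overrightarrow{BC},\overrightarrow{LM}\rangle_A=\langle\overrightarrow{AB},\overrightarrow{LM}\rangle_A+\langle\overrightarrow{BC},\overrightarrow{LM}\rangle_A$; $\langle-\overrightarrow{AB},\overrightarrow{CD}\rangle_A=-\langle\overrightarrow{AB},\overrightarrow{CD}\rangle_A$. Measure: $\|\overrightarrow{AB}\|_A=\sqrt{\langle\overrightarrow{AB},\overrightarrow{AB}\rangle_A}$. Scalar multiplication: for $t\in\mathbb{R}$,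 if $A=B$ or $t=0$ then $(t)\overrightarrow{AB}=\overrightarrow{AA}$. If $A\ne B$ and $t\neq0$ then $(t)\overrightarrow{AB}=\overrightarrow{AD}$, where $D\in\mathcal{P}$ is a point (assumed to exist) with $\|\overrightarrow{AD}\|_A=|t|\,\|\overrightarrow{AB}\|_A$ and $\langle\overrightarrow{AB},\overrightarrow{AD}\rangle_A=\|\overrightarrow{AB}\|_A\|\overrightarrow{AD}\|_A$ if $t>0$, $=-\|\overrightarrow{AB}\|_A\|\overrightarrow{AD}\|_A$ if $t<0$. Axiom 2: $\langle(t)\overrightarrow{AB},\overrightarrow{CD}\rangle_A=t\langle\overrightarrow{AB},\overrightarrow{CD}\rangle_A$ for all arrows and all $t\in\mathbb{R}$. Relation $\Re$ on $\mathcal{P}_A$: $\overrightarrow{AB}\;\Re\;\overrightarrow{CD}$ iff either $A=B$ and $C=D$, or ($A\ne B$, $C\neq D$ and) $\|\overrightarrow{AB}\|_A=\|\overrightarrow{CD}\|_A$ and $\frac{\langle\overrightarrow{AB},\overrightarrow{CD}\rangle_A}{\|\overrightarrow{AB}\|_A\|\overrightarrow{CD}\|_A}=1$. Axiom 4: if $\overrightarrow{AB}\;\Re\;\overrightarrow{CD}$ and $\overrightarrow{EF}\;\Re\;\overrightarrow{GH}$, then $\langle\overrightarrow{AB},\overrightarrow{EF}\rangle_A=\langle\overrightarrow{CD},\overrightarrow{GH}\rangle_A$. *)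

(* Defs.v *)
From mathcomp Require Import all_boot all_order all_algebra.
From mathcomp Require Import classical_sets cardinality reals.

Set Implicit Arguments.
Unset Strict Implicit.
Unset Printing Implicit Defensive.

Import Order.TTheory GRing.Theory Num.Theory.
Local Open Scope ring_scope.

Definition arrow (P : Type) : Type := (P * P)%type.

Section Arrows.
Variable P : Type.
Implicit Types a b : arrow P.

Definition arrow_tail a : P := a.1.
Definition arrow_head a : P := a.2.

Definition arrow_opp a : arrow P := (arrow_head a, arrow_tail a).

(* Partial operation: the last argument is the proof that the sum is defined. *)
Definition arrow_add a b (_ : arrow_head a = arrow_tail b) : arrow P :=
  (arrow_tail a, arrow_head b).

End Arrows.

Section ArrowSpace.
Variables (R : realType) (P : Type).
Implicit Types (ip : arrow P -> arrow P -> R) (a b c d : arrow P) (t : R).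

Record arrow_pre_inner_product ip : Prop := ArrowPreInnerProduct {
  ip_ge0 : forall a, 0 <= ip a a;
  ip_eq0 : forall a, ip a a = 0 <-> arrow_tail a = arrow_head a;
  ip_sym : forall a b, ip a b = ip b a;
  ip_add : forall a b c (h : arrow_head a = arrow_tail b),
    ip (arrow_add h) c = ip a c + ip b c;
  ip_opp : forall a b, ip (arrow_opp a) b = - ip a b }.

Definition arrow_measure ip a : R := Num.sqrt (ip a a).

(* [smul t a] is the arrow (t)a.  In the nondegenerate case the point [D] is
   only required to exist; the operation [smul] carries the choice of it. *)
Record scalar_multiplication ip (smul : R -> arrow P -> arrow P) : Prop :=
  ScalarMultiplication {
  smul_degenerate : forall t a, arrow_tail a = arrow_head a \/ t = 0 ->
    smul t a = (arrow_tail a, arrow_tail a);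
  smul_nondegenerate : forall t a, arrow_tail a <> arrow_head a -> t <> 0 ->
    exists D : P, let d := (arrow_tail a, D) in
      [/\ smul t a = d,
          arrow_measure ip d = `|t| * arrow_measure ip a,
          0 < t -> ip a d = arrow_measure ip a * arrow_measure ip d
        & t < 0 -> ip a d = - (arrow_measure ip a * arrow_measure ip d)] }.

Definition scalar_homogeneous ip (smul : R -> arrow P -> arrow P) : Prop :=
  forall t a b, ip (smul t a) b = t * ip a b.

Definition arrow_rel ip a b : Prop :=
  (arrow_tail a = arrow_head a /\ arrow_tail b = arrow_head b) \/
  [/\ arrow_tail a <> arrow_head a, arrow_tail b <> arrow_head b,
      arrow_measure ip a = arrow_measure ip b
    & ip a b / (arrow_measure ip a * arrow_measure ip b) = 1].

Definition ip_compatible ip : Prop :=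
  forall a b c d, arrow_rel ip a b -> arrow_rel ip c d -> ip a c = ip b d.

End ArrowSpace.

(* Main.v *)
(* For transitivity, Axiom 4 applied to [a ~ b] and [c ~ c] replaces [a] by [b]
   in the inner product with [c], and equality of the measures does the rest. *)
Require Import Defs.
From mathcomp Require Import all_boot all_order all_algebra.
From mathcomp Require Import classical_sets cardinality reals.
From mathcomp Require Import boolp.
From Stdlib Require Import RelationClasses.

Import GRing.Theory Num.Theory.

(** Degenerate arrows form one class; other arrows are related when they have equal measure and
    cosine 1. Reflexivity comes from definiteness and symmetry from [ip_sym]. Transitivity comes
    from [ip_compatible]: related arrows have the same product with any third arrow. *)

Lemma arrow_rel_refl (R : realType) (P : Type) (ip : arrow P -> arrow P -> R)
    (a : arrow P) :
  arrow_pre_inner_product ip -> arrow_rel ip a a.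
Proof.
move=> H; have [aE|aN] := pselect (arrow_tail a = arrow_head a); first by left.
(* Nonnegativity turns the squared measure back into [ip a a], so the cosine is [ip a a / ip a a],
   with nonzero denominator by definiteness. *)
right; split=> //; rewrite /arrow_measure -expr2 sqr_sqrtr ?(ip_ge0 H) //.
by rewrite divff //; apply/eqP => /(ip_eq0 H).
Qed.

Lemma arrow_rel_sym (R : realType) (P : Type) (ip : arrow P -> arrow P -> R)
    (a b : arrow P) :
  arrow_pre_inner_product ip -> arrow_rel ip a b -> arrow_rel ip b a.
Proof.
move=> H [[aE bE]|[aN bN mE cE]]; first by left.
by right; split=> //; rewrite (ip_sym H) [X in (_ / X)%R]mulrC.
Qed.

Lemma arrow_rel_trans (R : realType) (P : Type) (ip : arrow P -> arrow P -> R)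
    (a b c : arrow P) :
  arrow_pre_inner_product ip -> ip_compatible ip ->
  arrow_rel ip a b -> arrow_rel ip b c -> arrow_rel ip a c.
Proof.
move=> H ax4 ab bc; have acE := ax4 _ _ _ _ ab (arrow_rel_refl _ _ _ c H).
(* The mixed cases would make [b] both degenerate and nondegenerate. *)
case: ab bc => [[aE bE]|[aN bN abm _]] [[bE' cE]|[bN' cN bcm bc1]] //.
  by left.
by right; split=> //; rewrite ?acE abm.
Qed.

Theorem theorem43 (R : realType) (P : Type)
    (ip : arrow P -> arrow P -> R) (smul : R -> arrow P -> arrow P)
    (P_infinite : infinite_set [set: P]%classic)
    (axiom1 : arrow_pre_inner_product ip)
    (smulP : scalar_multiplication ip smul)
    (axiom2 : scalar_homogeneous ip smul)
    (axiom4 : ip_compatible ip) :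
  Equivalence (arrow_rel ip).
Proof.
split.
- by move=> a; exact: arrow_rel_refl.
- by move=> a b; exact: arrow_rel_sym.
- by move=> a b c; exact: arrow_rel_trans.
Qed.
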